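(* Let $A$ be a local $F$-coherent ring of prime characteristic and let $B$ be weakly étale over $A$. Then $B$ is $F$-coherent.
   Context: All rings are commutative; local rings are noetherian. For a ring $A$ of prime characteristic $p$ with Frobenius map $F(a)=a^p$, the perfect closure is $A^\infty=\varinjlim(A\xrightarrow{F}A\xrightarrow{F}\cdots)$, and $A$ is $F$-coherent if $A^\infty$ is a coherent ring (every finitely generated ideal is finitely presented). A ring map $A\to B$ is weakly étale (absolutely flat) if both $A\to B$ and the multiplication map $B\otimes_A B\to B$ are flat. *)

(* Defs.v *)
From HB Require Import structures.
From mathcomp Require Import all_boot all_order all_algebra.
From mathcomp Require Import zify boolp classical_sets.

Set Implicit Arguments.
Unset Strict Implicit.
Unset Printing Implicit Defensive.

Import GRing.Theory.
Local Open Scope ring_scope.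
Local Open Scope quotient_scope.
Local Open Scope classical_set_scope.

(* Rings are [comPzRingType]s, so that the zero ring is allowed.              *)

Section FinitelyPresented.
Variables (R : comPzRingType) (M : lmodType R).

Definition fin_gen (N : set M) : Prop :=
  exists (n : nat) (g : 'I_n -> M),
    N = [set x | exists c : 'I_n -> R, x = \sum_(i < n) c i *: g i].

(* There is an exact sequence R^m -> R^n -> N -> 0.                           *)
Definition fin_pres (N : set M) : Prop :=
  exists (n : nat) (f : {linear 'rV[R]_n -> M}),
    range f = N /\
    exists (m : nat) (g : {linear 'rV[R]_m -> 'rV[R]_n}),
      range g = [set v | f v = 0].

End FinitelyPresented.

Section Ideals.
Variable R : comPzRingType.

Definition is_ideal (I : set R) : Prop :=
  [/\ I 0, forall x y, I x -> I y -> I (x + y) & forall a x, I x -> I (a * x)].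

Definition maximal_ideal (I : set R) : Prop :=
  [/\ is_ideal I, ~ I 1 &
      forall J : set R, is_ideal J -> I `<=` J -> J = I \/ J = setT].

Definition noetherian_ring : Prop :=
  forall I : set R, is_ideal I -> fin_gen (I : set R^o).

(* Following the convention that local rings are noetherian.                  *)
Definition local_ring : Prop :=
  noetherian_ring /\ exists! I : set R, maximal_ideal I.

Definition coherent_ring : Prop :=
  forall I : set R^o, fin_gen I -> fin_pres I.

End Ideals.

(* The colimit of R -> R -> R -> ..., all the maps being the endomorphism phi *)
(* of R. The pair (n, a) represents the image of the element a of the n-th    *)
(* copy of R; two pairs are identified when they become equal in some later   *)
(* copy.                                                                      *)
Section Colimit.
Variables (R : comPzRingType) (phi : {rmorphism R -> R}).

Definition colim_eq (u v : nat * R) : bool :=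
  `[< exists i j : nat, (u.1 + i = v.1 + j)%N /\
        iter i phi u.2 = iter j phi v.2 >].

Let iter_rmorph k : exists h : {rmorphism R -> R}, iter k phi =1 h.
Proof.
elim: k => [|k [h hE]]; first by exists idfun.
by exists (phi \o h) => x /=; rewrite hE.
Qed.

Lemma colim_eq_refl : reflexive colim_eq.
Proof. by move=> u; apply/asboolP; exists 0%N, 0%N. Qed.

Lemma colim_eq_sym : symmetric colim_eq.
Proof.
by move=> u v; apply/asboolP/asboolP=> -[i [j [eij e]]]; exists j, i.
Qed.

Lemma colim_eq_trans : transitive colim_eq.
Proof.
move=> v u w /asboolP[i [j [e1 e2]]] /asboolP[k [l [e3 e4]]].
apply/asboolP; exists (k + i)%N, (j + l)%N; split; first by lia.
by rewrite !iterD e2 -e4 -!iterD addnC.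
Qed.

Canonical colim_equiv :=
  EquivRel colim_eq colim_eq_refl colim_eq_sym colim_eq_trans.

Definition colim : Type := {eq_quot colim_eq}.
HB.instance Definition _ := Choice.on colim.
HB.instance Definition _ := EqQuotient.on colim.

Definition colim_in (n : nat) (a : R) : colim := \pi_colim (n, a).

Lemma colim_inP m n a b : colim_in m a = colim_in n b <->
  exists i j : nat, (m + i = n + j)%N /\ iter i phi a = iter j phi b.
Proof.
by rewrite /colim_in; split=> [/eqmodP/asboolP|?]; last exact/eqmodP/asboolP.
Qed.

Lemma colim_in_iter k n a : colim_in (n + k) (iter k phi a) = colim_in n a.
Proof. by apply/colim_inP; exists 0%N, k; rewrite addn0. Qed.

Lemma colim_inE (x : colim) : x = colim_in (repr x).1 (repr x).2.
Proof. by rewrite /colim_in -surjective_pairing reprK. Qed.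

Definition colim_zero : colim := colim_in 0 0.
Definition colim_one : colim := colim_in 0 1.
Definition colim_opp (x : colim) : colim :=
  colim_in (repr x).1 (- (repr x).2).
Definition colim_add (x y : colim) : colim :=
  colim_in ((repr x).1 + (repr y).1)
    (iter (repr y).1 phi (repr x).2 + iter (repr x).1 phi (repr y).2).
Definition colim_mul (x y : colim) : colim :=
  colim_in ((repr x).1 + (repr y).1)
    (iter (repr y).1 phi (repr x).2 * iter (repr x).1 phi (repr y).2).

Let repr_in n a : exists i j : nat,
  (n + i = (repr (colim_in n a)).1 + j)%N /\
  iter i phi a = iter j phi (repr (colim_in n a)).2.
Proof. by apply/colim_inP; rewrite -colim_inE. Qed.

Lemma colim_inN n a : colim_opp (colim_in n a) = colim_in n (- a).
Proof.
have [i [j [e1 e2]]] := repr_in n a; apply/colim_inP; exists j, i.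
split=> //; have [h hE] := iter_rmorph i; have [h' hE'] := iter_rmorph j.
by move: e2; rewrite !hE !hE' !rmorphN => ->.
Qed.

Let colim_in_op (op : R -> R -> R) m n a b :
    (forall h : {rmorphism R -> R}, {morph h : x y / op x y}) ->
  let x := colim_in m a in let y := colim_in n b in
  colim_in ((repr x).1 + (repr y).1)
    (op (iter (repr y).1 phi (repr x).2) (iter (repr x).1 phi (repr y).2)) =
  colim_in (m + n) (op (iter n phi a) (iter m phi b)).
Proof.
move=> opM x y; have [i [j [e1 e2]]] := repr_in m a.
rewrite -/x in e1 e2.
have [k [l [e3 e4]]] := repr_in n b.
rewrite -/y in e3 e4.
have itM c u v : iter c phi (op u v) = op (iter c phi u) (iter c phi v).
  by have [h hE] := iter_rmorph c; rewrite !hE opM.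
apply/colim_inP; exists (j + l)%N, (i + k)%N; split; first by lia.
rewrite !itM -!iterD.
have -> : (j + l + (repr y).1 = (n + k) + j)%N by lia.
have -> : (i + k + n = (n + k) + i)%N by lia.
have -> : (j + l + (repr x).1 = (m + i) + l)%N by lia.
have -> : (i + k + m = (m + i) + k)%N by lia.
rewrite ![iter (_ + i)%N phi _]iterD ![iter (_ + k)%N phi _]iterD.
by rewrite e2 e4 -!iterD.
Qed.

Lemma colim_inD n a b :
  colim_add (colim_in n a) (colim_in n b) = colim_in n (a + b).
Proof.
rewrite /colim_add (@colim_in_op +%R) => [|h]; last exact: rmorphD.
rewrite -(colim_in_iter n n (a + b)).
by have [h hE] := iter_rmorph n; rewrite !hE rmorphD.
Qed.

Lemma colim_inM n a b :
  colim_mul (colim_in n a) (colim_in n b) = colim_in n (a * b).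
Proof.
rewrite /colim_mul (@colim_in_op *%R) => [|h]; last exact: rmorphM.
rewrite -(colim_in_iter n n (a * b)).
by have [h hE] := iter_rmorph n; rewrite !hE rmorphM.
Qed.

Lemma colim_in0 n : colim_in n 0 = colim_zero.
Proof.
rewrite /colim_zero -(colim_in_iter n 0 0) add0n.
by have [h hE] := iter_rmorph n; rewrite hE rmorph0.
Qed.

Lemma colim_in1 n : colim_in n 1 = colim_one.
Proof.
rewrite /colim_one -(colim_in_iter n 0 1) add0n.
by have [h hE] := iter_rmorph n; rewrite hE rmorph1.
Qed.

Lemma colim_common (x y z : colim) : exists n a b c,
  [/\ x = colim_in n a, y = colim_in n b & z = colim_in n c].
Proof.
rewrite (colim_inE x) (colim_inE y) (colim_inE z).
move: (repr x) (repr y) (repr z) => [m a] [n b] [k c] /=.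
exists (m + n + k)%N, (iter (n + k) phi a), (iter (m + k) phi b),
  (iter (m + n) phi c).
split; first by rewrite -addnA colim_in_iter.
  by rewrite [(m + n)%N]addnC -addnA colim_in_iter.
by rewrite [(m + n + k)%N]addnC colim_in_iter.
Qed.

Lemma colim_addA : associative colim_add.
Proof.
move=> x y z; have [n [a [b [c [-> -> ->]]]]] := colim_common x y z.
by rewrite !colim_inD addrA.
Qed.

Lemma colim_addC : commutative colim_add.
Proof.
move=> x y; have [n [a [b [c [-> -> _]]]]] := colim_common x y x.
by rewrite !colim_inD addrC.
Qed.

Lemma colim_add0 : left_id colim_zero colim_add.
Proof.
move=> x; rewrite (colim_inE x) -(colim_in0 (repr x).1).
by rewrite colim_inD add0r.
Qed.

Lemma colim_addN : left_inverse colim_zero colim_opp colim_add.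
Proof.
by move=> x; rewrite (colim_inE x) colim_inN colim_inD addNr colim_in0.
Qed.

HB.instance Definition _ :=
  GRing.isZmodule.Build colim colim_addA colim_addC colim_add0 colim_addN.

Lemma colim_mulA : associative colim_mul.
Proof.
move=> x y z; have [n [a [b [c [-> -> ->]]]]] := colim_common x y z.
by rewrite !colim_inM mulrA.
Qed.

Lemma colim_mulC : commutative colim_mul.
Proof.
move=> x y; have [n [a [b [c [-> -> _]]]]] := colim_common x y x.
by rewrite !colim_inM mulrC.
Qed.

Lemma colim_mul1 : left_id colim_one colim_mul.
Proof.
move=> x; rewrite (colim_inE x) -(colim_in1 (repr x).1).
by rewrite colim_inM mul1r.
Qed.

Lemma colim_mulDl : left_distributive colim_mul +%R.
Proof.
move=> x y z; have [n [a [b [c [-> -> ->]]]]] := colim_common x y z.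
by rewrite [LHS](congr1 (colim_mul^~ _) (colim_inD _ _ _)) !colim_inM
  [RHS]colim_inD mulrDl.
Qed.

HB.instance Definition _ := GRing.Zmodule_isComPzRing.Build colim
  colim_mulA colim_mulC colim_mul1 colim_mulDl.

End Colimit.

(* The library's [pchar R] is restricted to nonzero rings.                    *)
Definition prime_char (p : nat) (R : comPzRingType) : Prop :=
  prime p /\ p%:R = 0 :> R.

Lemma prime_char_rmorph p (R S : comPzRingType) (f : {rmorphism R -> S}) :
  prime_char p R -> prime_char p S.
Proof. by case=> p_pr p0; split=> //; rewrite -(rmorph_nat f) p0 rmorph0. Qed.

Section Frobenius.
Variables (p : nat) (R : comPzRingType) (charR : prime_char p R).

Definition Frobenius of prime_char p R := fun a : R => a ^+ p.
Local Notation F := (Frobenius charR).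

Lemma Frobenius_is_zmod_morphism : zmod_morphism F.
Proof.
have [p_pr p0] := charR.
have FD a b : F (a + b) = F a + F b.
  rewrite /Frobenius exprDn -(prednK (prime_gt0 p_pr)).
  rewrite big_ord_recl big_ord_recr /= subn0 subnn !expr0 mulr1 mul1r.
  rewrite bin0 binn !mulr1n big1 ?add0r // => i _.
  rewrite /bump /= prednK ?prime_gt0 // -mulr_natr.
  have /dvdnP[k ->] : (p %| 'C(p, 1 + i))%N.
    apply: prime_dvd_bin => //=.
    by rewrite add1n /= -[ltnRHS](prednK (prime_gt0 p_pr)) ltnS.
  by rewrite natrM p0 !mulr0.
have F0 : F 0 = 0 by rewrite /Frobenius expr0n gtn_eqF ?prime_gt0.
have FN b : F (- b) = - F b.
  by apply/eqP; rewrite -addr_eq0 -FD addNr F0.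
by move=> a b; rewrite FD FN.
Qed.

Lemma Frobenius_is_monoid_morphism : monoid_morphism F.
Proof. by split=> [|a b]; rewrite /Frobenius ?expr1n ?exprMn. Qed.

HB.instance Definition _ :=
  GRing.isZmodMorphism.Build R R F Frobenius_is_zmod_morphism.
HB.instance Definition _ :=
  GRing.isMonoidMorphism.Build R R F Frobenius_is_monoid_morphism.

Definition perfect_closure : comPzRingType := colim F.

Definition F_coherent : Prop := coherent_ring perfect_closure.

End Frobenius.

(* The tensor product is presented by generators and relations: its elements  *)
(* are formal sums of pairs (x, y), written as lists, modulo the smallest     *)
(* congruence [tensor_eq] making (x, y) biadditive and R-balanced. This       *)
(* quotient is already a group, the opposite of (x, y) being (- x, y).        *)
Section Tensor.
Variables (R : comPzRingType) (M N : lmodType R).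

Inductive tensor_eq : seq (M * N) -> seq (M * N) -> Prop :=
| TensorRefl s : tensor_eq s s
| TensorSym s t : tensor_eq s t -> tensor_eq t s
| TensorTrans s t u : tensor_eq s t -> tensor_eq t u -> tensor_eq s u
| TensorCat s s' t t' :
    tensor_eq s s' -> tensor_eq t t' -> tensor_eq (s ++ t) (s' ++ t')
| TensorCatC s t : tensor_eq (s ++ t) (t ++ s)
| TensorZero y : tensor_eq [:: (0, y)] [::]
| TensorDl x x' y : tensor_eq [:: (x + x', y)] [:: (x, y); (x', y)]
| TensorDr x y y' : tensor_eq [:: (x, y + y')] [:: (x, y); (x, y')]
| TensorZ a x y : tensor_eq [:: (a *: x, y)] [:: (x, a *: y)].

Definition tensor_eqb s t : bool := `[< tensor_eq s t >].

Lemma tensor_eqb_refl : reflexive tensor_eqb.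
Proof. by move=> s; apply/asboolP; constructor. Qed.

Lemma tensor_eqb_sym : symmetric tensor_eqb.
Proof. by move=> s t; apply/asboolP/asboolP; apply: TensorSym. Qed.

Lemma tensor_eqb_trans : transitive tensor_eqb.
Proof.
by move=> t s u /asboolP st /asboolP tu; apply/asboolP; apply: TensorTrans tu.
Qed.

Canonical tensor_equiv :=
  EquivRel tensor_eqb tensor_eqb_refl tensor_eqb_sym tensor_eqb_trans.

Definition tensor : Type := {eq_quot tensor_eqb}.
HB.instance Definition _ := Choice.on tensor.
HB.instance Definition _ := EqQuotient.on tensor.

Definition tensor_of (s : seq (M * N)) : tensor := \pi_tensor s.

Lemma tensor_ofP s t : tensor_of s = tensor_of t <-> tensor_eq s t.
Proof.
by rewrite /tensor_of; split=> [/eqmodP/asboolP|?]; last exact/eqmodP/asboolP.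
Qed.

Lemma tensor_ofK x : tensor_of (repr x) = x.
Proof. exact: reprK. Qed.

Lemma repr_tensor_of s : tensor_eq (repr (tensor_of s)) s.
Proof. by apply/tensor_ofP; rewrite tensor_ofK. Qed.

Definition tensor_zero : tensor := tensor_of [::].
Definition tensor_add (x y : tensor) : tensor := tensor_of (repr x ++ repr y).
Definition tensor_opp (x : tensor) : tensor :=
  tensor_of [seq (- u.1, u.2) | u <- repr x].

Lemma tensor_of_cat s t :
  tensor_add (tensor_of s) (tensor_of t) = tensor_of (s ++ t).
Proof. by apply/tensor_ofP; apply: TensorCat; apply: repr_tensor_of. Qed.

Lemma tensor_addA : associative tensor_add.
Proof.
move=> x y z; rewrite -(tensor_ofK x) -(tensor_ofK y) -(tensor_ofK z).
by rewrite !tensor_of_cat catA.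
Qed.

Lemma tensor_addC : commutative tensor_add.
Proof. by move=> x y; apply/tensor_ofP; apply: TensorCatC. Qed.

Lemma tensor_add0 : left_id tensor_zero tensor_add.
Proof. by move=> x; rewrite -(tensor_ofK x) tensor_of_cat. Qed.

Lemma tensor_addN : left_inverse tensor_zero tensor_opp tensor_add.
Proof.
move=> x; rewrite -{2}(tensor_ofK x) tensor_of_cat; apply/tensor_ofP.
elim: (repr x) => [|[m n] s IHs] /=; first exact: TensorRefl.
pose s' := [seq (- u.1, u.2) | u <- s] : seq (M * N).
apply: (@TensorTrans _ ([:: (- m, n); (m, n)] ++ (s' ++ s))).
  rewrite -/s' -[_ :: _ ++ _]/([:: (- m, n)] ++ (s' ++ ([:: (m, n)] ++ s))).
  rewrite -[[:: _; _]]/([:: (- m, n)] ++ [:: (m, n)]) -catA.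
  apply: TensorCat; first exact: TensorRefl.
  rewrite !catA; apply: TensorCat; last exact: TensorRefl.
  exact: TensorCatC.
rewrite -[[::] in X in tensor_eq _ X]cats0; apply: TensorCat IHs.
apply: (@TensorTrans _ [:: (- m + m, n)]); first exact/TensorSym/TensorDl.
by rewrite addNr; apply: TensorZero.
Qed.

HB.instance Definition _ := GRing.isZmodule.Build tensor
  tensor_addA tensor_addC tensor_add0 tensor_addN.

Definition pure (x : M) (y : N) : tensor := tensor_of [:: (x, y)].

Definition balanced (G : zmodType) (h : M -> N -> G) : Prop :=
  [/\ forall x x' y, h (x + x') y = h x y + h x' y,
      forall x y y', h x (y + y') = h x y + h x y' &
      forall a x y, h (a *: x) y = h x (a *: y)].

Lemma pure_balanced : balanced pure.
Proof.
split=> [x x' y|x y y'|a x y].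
- by rewrite [RHS]tensor_of_cat; apply/tensor_ofP; apply: TensorDl.
- by rewrite [RHS]tensor_of_cat; apply/tensor_ofP; apply: TensorDr.
- by apply/tensor_ofP; apply: TensorZ.
Qed.

Lemma tensor_ind (P : tensor -> Prop) :
    P 0 -> (forall x y, P (pure x y)) ->
    (forall u v, P u -> P v -> P (u + v)) ->
  forall u, P u.
Proof.
move=> P0 Pp PD u; rewrite -(tensor_ofK u).
elim: (repr u) => [|[x y] s IHs]; first exact: P0.
have -> : tensor_of ((x, y) :: s) = pure x y + tensor_of s.
  by rewrite [RHS]tensor_of_cat.
exact: PD.
Qed.

(* The map induced by h on the tensor product; meaningful for h balanced.     *)
Definition tensor_lift (G : zmodType) (h : M -> N -> G) (u : tensor) : G :=
  \sum_(w <- repr u) h w.1 w.2.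

Section Lift.
Variables (G : zmodType) (h : M -> N -> G) (hB : balanced h).

Lemma tensor_lift_of s :
  tensor_lift h (tensor_of s) = \sum_(w <- s) h w.1 w.2.
Proof.
have [hDl hDr hZ] := hB; rewrite /tensor_lift.
move: (repr _) (repr_tensor_of s) => t; elim=> {s t} //=.
- by move=> s t u _ -> _ ->.
- by move=> s s' t t' _ e1 _ e2; rewrite !big_cat e1 e2.
- by move=> s t; rewrite !big_cat /= addrC.
- move=> y; rewrite big_seq1 big_nil /=.
  by apply: (addrI (h 0 y)); rewrite -hDl !addr0.
- by move=> x x' y; rewrite big_seq1 big_cons big_seq1 /= hDl.
- by move=> x y y'; rewrite big_seq1 big_cons big_seq1 /= hDr.
- by move=> a x y; rewrite !big_seq1 /= hZ.
Qed.

Lemma tensor_lift_pure x y : tensor_lift h (pure x y) = h x y.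
Proof. by rewrite tensor_lift_of big_seq1. Qed.

Lemma tensor_lift0 : tensor_lift h 0 = 0.
Proof. by rewrite tensor_lift_of big_nil. Qed.

Lemma tensor_liftD u v :
  tensor_lift h (u + v) = tensor_lift h u + tensor_lift h v.
Proof.
rewrite -(tensor_ofK u) -(tensor_ofK v) [X in tensor_lift h X]tensor_of_cat.
by rewrite !tensor_lift_of big_cat.
Qed.

End Lift.
End Tensor.

Section Flat.
Variable R : comPzRingType.

(* f (x) id : L (x) M -> L' (x) M                                             *)
Definition tensor_map (L L' M : lmodType R) (f : {linear L -> L'}) :
  tensor L M -> tensor L' M := tensor_lift (fun x y => pure (f x) y).

Definition flat_module (M : lmodType R) : Prop :=
  forall (L L' : lmodType R) (f : {linear L -> L'}),
    injective f -> injective (@tensor_map L L' M f).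

End Flat.

(* S viewed as an R-module through f.                                         *)
Definition restrict (R S : comPzRingType) (f : {rmorphism R -> S}) : Type := S.

Section Restrict.
Variables (R S : comPzRingType) (f : {rmorphism R -> S}).

HB.instance Definition _ := GRing.ComPzRing.on (restrict f).

Definition restrict_scale (a : R) (x : restrict f) : restrict f :=
  (f a : restrict f) * x.

Lemma restrict_scaleA a b x :
  restrict_scale a (restrict_scale b x) = restrict_scale (a * b) x.
Proof. by rewrite /restrict_scale mulrA [f (a * b)]rmorphM. Qed.

Lemma restrict_scale1 : left_id 1 restrict_scale.
Proof. by move=> x; rewrite /restrict_scale rmorph1 mul1r. Qed.

Lemma restrict_scaleDr : right_distributive restrict_scale +%R.
Proof. by move=> a x y; rewrite /restrict_scale mulrDr. Qed.

Lemma restrict_scaleDl x : {morph restrict_scale^~ x : a b / a + b}.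
Proof. by move=> a b; rewrite /restrict_scale [f (a + b)]rmorphD mulrDl. Qed.

HB.instance Definition _ := GRing.Zmodule_isLmodule.Build R (restrict f)
  restrict_scaleA restrict_scale1 restrict_scaleDr restrict_scaleDl.

Lemma restrict_scaleE (a : R) (x : restrict f) : a *: x = (f a : S) * x :> S.
Proof. by []. Qed.

Definition flat_map : Prop := flat_module (restrict f).

End Restrict.

(* S (x)_R S as a ring, for S an R-algebra through f.                         *)
Section TensorSquare.
Variables (R S : comPzRingType) (f : {rmorphism R -> S}).
Local Notation Sf := (restrict f).

Definition tensor_sq : Type := tensor Sf Sf.
HB.instance Definition _ := GRing.Zmodule.on tensor_sq.

Local Notation tpure := (@pure R Sf Sf : Sf -> Sf -> tensor_sq).

Definition tsq_one : tensor_sq := tpure 1 1.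

(* (x (x) y) * (x' (x) y') = (x * x') (x) (y * y')                            *)
Definition tsq_mul (u v : tensor_sq) : tensor_sq :=
  tensor_lift (fun x y : Sf =>
    tensor_lift (fun x' y' : Sf => tpure (x * x') (y * y')) v) u.

Let tpureDl x x' y : tpure (x + x') y = tpure x y + tpure x' y.
Proof. by have [] := @pure_balanced R Sf Sf. Qed.
Let tpureDr x y y' : tpure x (y + y') = tpure x y + tpure x y'.
Proof. by have [] := @pure_balanced R Sf Sf. Qed.
Let tpureZ a x y : tpure (a *: x) y = tpure x (a *: y).
Proof. by have [] := @pure_balanced R Sf Sf. Qed.
Let scaleAl (a : R) (x y : Sf) : (a *: x) * y = a *: (x * y).
Proof. by rewrite /GRing.scale /= /restrict_scale mulrA. Qed.
Let scaleAr (a : R) (x y : Sf) : x * (a *: y) = a *: (x * y).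
Proof. by rewrite mulrC scaleAl mulrC. Qed.

Let inner_balanced (x y : Sf) :
  balanced (fun x' y' : Sf => tpure (x * x') (y * y')).
Proof.
split=> [a b c|a b c|a b c]; first by rewrite mulrDr tpureDl.
  by rewrite mulrDr tpureDr.
by rewrite !scaleAr tpureZ.
Qed.

Let outer_balanced (v : tensor_sq) : balanced (fun x y : Sf =>
  tensor_lift (fun x' y' : Sf => tpure (x * x') (y * y')) v).
Proof.
split=> [x x' y|x y y'|a x y]; rewrite /tensor_lift -?big_split /=;
  apply: eq_bigr => w _.
- by rewrite mulrDl tpureDl.
- by rewrite mulrDl tpureDr.
- by rewrite !scaleAl tpureZ.
Qed.

Lemma tsq_mul_pure x y x' y' :
  tsq_mul (tpure x y) (tpure x' y') = tpure (x * x') (y * y').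
Proof. by rewrite /tsq_mul !tensor_lift_pure. Qed.

Lemma tsq_mul0l v : tsq_mul 0 v = 0.
Proof. exact: tensor_lift0. Qed.

Lemma tsq_mulDl : left_distributive tsq_mul +%R.
Proof. by move=> u u' v; apply: tensor_liftD. Qed.

Lemma tsq_mulC : commutative tsq_mul.
Proof.
have mul0r v : tsq_mul v 0 = 0.
  by rewrite /tsq_mul {1}/tensor_lift big1 // => w _; rewrite tensor_lift0.
have mulDr u v v' : tsq_mul u (v + v') = tsq_mul u v + tsq_mul u v'.
  rewrite /tsq_mul {1 3 5}/tensor_lift -big_split /=.
  by apply: eq_bigr => w _; rewrite tensor_liftD.
move=> u v; elim/tensor_ind: u => [|x y|u u' IHu IHu'].
- by rewrite tsq_mul0l mul0r.
- elim/tensor_ind: v => [|x' y'|v v' IHv IHv'].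
  + by rewrite tsq_mul0l mul0r.
  + by rewrite !tsq_mul_pure mulrC [y * _]mulrC.
  + by rewrite tsq_mulDl mulDr IHv IHv'.
- by rewrite tsq_mulDl mulDr IHu IHu'.
Qed.

Lemma tsq_mul0r v : tsq_mul v 0 = 0.
Proof. by rewrite tsq_mulC tsq_mul0l. Qed.

Lemma tsq_mulDr : right_distributive tsq_mul +%R.
Proof. by move=> u v w; rewrite ![tsq_mul u _]tsq_mulC tsq_mulDl. Qed.

Lemma tsq_mulA : associative tsq_mul.
Proof.
move=> u v w; elim/tensor_ind: u => [|x y|u u' IHu IHu'].
- by rewrite !tsq_mul0l.
- elim/tensor_ind: v => [|x' y'|v v' IHv IHv'].
  + by rewrite tsq_mul0l !tsq_mul0r tsq_mul0l.
  + elim/tensor_ind: w => [|x'' y''|w w' IHw IHw'].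
    * by rewrite !tsq_mul0r.
    * by rewrite !tsq_mul_pure !mulrA.
    * by rewrite !tsq_mulDr IHw IHw'.
  + by rewrite tsq_mulDl !tsq_mulDr tsq_mulDl IHv IHv'.
- by rewrite !tsq_mulDl IHu IHu'.
Qed.

Lemma tsq_mul1 : left_id tsq_one tsq_mul.
Proof.
move=> u; elim/tensor_ind: u => [|x y|u v IHu IHv].
- exact: tsq_mul0r.
- by rewrite tsq_mul_pure !mul1r.
- by rewrite tsq_mulDr IHu IHv.
Qed.

HB.instance Definition _ := GRing.Zmodule_isComPzRing.Build tensor_sq
  tsq_mulA tsq_mulC tsq_mul1 tsq_mulDl.

Definition mult_map (u : tensor_sq) : S :=
  tensor_lift (fun x y : Sf => (x * y : S)) u.

Lemma mult_balanced : balanced (fun x y : Sf => (x * y : S)).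
Proof.
split=> [x x' y|x y y'|a x y]; [exact: mulrDl | exact: mulrDr |].
by rewrite [LHS]scaleAl [RHS]scaleAr.
Qed.

Lemma mult_map_pure x y : mult_map (tpure x y) = x * y.
Proof. exact: (tensor_lift_pure mult_balanced). Qed.

Lemma mult_map_is_zmod_morphism : zmod_morphism mult_map.
Proof.
move=> u v; apply: (addIr (mult_map v)).
by rewrite -(tensor_liftD mult_balanced) !subrK.
Qed.

HB.instance Definition _ :=
  GRing.isZmodMorphism.Build tensor_sq S mult_map mult_map_is_zmod_morphism.

Lemma mult_map_is_monoid_morphism : monoid_morphism mult_map.
Proof.
split=> [|u v]; first by rewrite [LHS]mult_map_pure mulr1.
elim/tensor_ind: u => [|x y|u u' IHu IHu'].
- by rewrite mul0r raddf0 mul0r.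
- elim/tensor_ind: v => [|x' y'|v v' IHv IHv'].
  + by rewrite mulr0 raddf0 mulr0.
  + by rewrite [_ * _]tsq_mul_pure !mult_map_pure mulrACA.
  + by rewrite mulrDr !raddfD /= IHv IHv' mulrDr.
- by rewrite mulrDl !raddfD /= IHu IHu' mulrDl.
Qed.

HB.instance Definition _ := GRing.isMonoidMorphism.Build tensor_sq S mult_map
  mult_map_is_monoid_morphism.

Definition weakly_etale : Prop := flat_map f /\ flat_map mult_map.

End TensorSquare.

(* Main.v *)
From HB Require Import structures.
From mathcomp Require Import all_boot all_order all_algebra.
From mathcomp Require Import boolp classical_sets functions.
Require Import Defs.

Set Implicit Arguments.
Unset Strict Implicit.
Unset Printing Implicit Defensive.

Import GRing.Theory.
Local Open Scope ring_scope.
Local Open Scope classical_set_scope.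

(** Weakly etale ring maps preserve coherence, and the perfect closure
    [A^oo -> B^oo] of a weakly etale map [A -> B] is again weakly etale, being
    a filtered colimit of copies of [A -> B]. So [B^oo] is coherent as soon as
    [A^oo] is.

    For the first fact, let [R -> S] be weakly etale with [R] coherent. By
    Chase, products of flat [R]-modules are flat, so every power [S^K] is
    [R]-flat. An [S]-module which is flat over [R] is flat over [S]: flatness
    of the multiplication [S (x) S -> S] yields, for any finite family [b] of
    [S], a tensor [e] with product [1] killed by all [b_i (x) 1 - 1 (x) b_i].
    Given a relation [\sum_i b_i m_i = 0], multiplying by [e] turns it into
    the vanishing of [\sum_i b_i e (1 (x) m_i)] in [S (x)_R M], hence into
    relations with coefficients in [R], which are trivial by [R]-flatness.
    Thus [S^K] is [S]-flat. Apply this to the tautological relation between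
    [b] and the universal family of its own relations, [K] being the set of
    all relations [c], with [m_i] the function [c |-> c_i]: its triviality
    says exactly that the module of relations of [b] is finitely generated.

    Flatness is handled through the equational criterion: only the
    implication from flat to [equationally_flat] ([flat_module_equational]) is
    used, applied to [A -> B] and to the multiplication of [B (x)_A B]. From
    there everything is expressed with finitely many elements, so that passing
    to the colimit amounts to choosing a stage where they all live
    ([colim_map_equationally_flat], [colim_map_locally_separated]). The
    coherence argument is [weakly_etale_fin_gen_relations]. *)

(** * Trivial relations and equational flatness *)

Section MatrixAction.
Variables (R : comPzRingType) (M : lmodType R).

Definition mxact m n (C : 'M[R]_(m, n)) (w : 'I_n -> M) (i : 'I_m) : M :=
  \sum_j C i j *: w j.

Lemma mxactM m n k (C : 'M[R]_(m, n)) (D : 'M_(n, k)) w :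
  mxact (C *m D) w = mxact C (mxact D w).
Proof.
apply/funext=> i; rewrite /mxact.
under eq_bigr do rewrite mxE scaler_suml.
rewrite exchange_big; apply: eq_bigr => j _; rewrite scaler_sumr.
by apply: eq_bigr => l _; rewrite scalerA.
Qed.

Lemma mxact1 n (w : 'I_n -> M) : mxact 1%:M w = w.
Proof.
apply/funext=> i; rewrite /mxact (bigD1 i) //= big1 ?mxE ?eqxx ?scale1r ?addr0 //.
by move=> j /negPf ji; rewrite mxE eq_sym ji scale0r.
Qed.

Lemma mxact0 m n (w : 'I_n -> M) : mxact (0 : 'M_(m, n)) w = fun=> 0.
Proof. by apply/funext=> i; rewrite /mxact big1 // => j _; rewrite mxE scale0r. Qed.

Lemma mxactB m n (C D : 'M_(m, n)) (w : 'I_n -> M) i :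
  mxact (C - D) w i = mxact C w i - mxact D w i.
Proof.
rewrite /mxact -sumrB; apply: eq_bigr => j _.
by rewrite !mxE scalerDl scaleNr.
Qed.

Definition join_fam m n (v : 'I_m -> M) (w : 'I_n -> M) (i : 'I_(m + n)) : M :=
  match fintype.split i with inl j => v j | inr j => w j end.

Lemma join_fam_lshift m n (v : 'I_m -> M) (w : 'I_n -> M) i :
  join_fam v w (lshift n i) = v i.
Proof.
by rewrite /join_fam -[lshift n i]/(unsplit (inl i)) unsplitK.
Qed.

Lemma join_fam_rshift m n (v : 'I_m -> M) (w : 'I_n -> M) i :
  join_fam v w (rshift m i) = w i.
Proof.
by rewrite /join_fam -[rshift m i]/(unsplit (inr i)) unsplitK.
Qed.

Lemma mxact_row m n k (C : 'M_(k, m)) (D : 'M_(k, n)) v w i :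
  mxact (row_mx C D) (join_fam v w) i = mxact C v i + mxact D w i.
Proof.
rewrite /mxact big_split_ord /=; congr (_ + _); apply: eq_bigr => j _.
  by rewrite row_mxEl join_fam_lshift.
by rewrite row_mxEr join_fam_rshift.
Qed.

(** The linear relation [a] between the entries of [m] holds for a formal
    reason: the family [m] comes from another one by scalars that already
    satisfy the relation. *)
Definition trivial_relation n (a : 'rV[R]_n) (m : 'I_n -> M) : Prop :=
  exists k (C : 'M_(n, k)) (w : 'I_k -> M), m = mxact C w /\ a *m C = 0.

(** The equational criterion of flatness, taken as a definition: it mentions
    finitely many elements of [R] and [M] and no tensor product, so that it
    passes easily to products and to filtered colimits. *)
Definition equationally_flat : Prop :=
  forall n (a : 'rV[R]_n) (m : 'I_n -> M), mxact a m 0 = 0 ->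
  trivial_relation a m.

End MatrixAction.

(** * Vanishing of tensors over a flat module *)

Section PureTensors.
Variables (R : comPzRingType) (N M : lmodType R).

Lemma pure0r (x : N) : pure x (0 : M) = 0.
Proof.
have [_ Dr _] := @pure_balanced R N M.
by apply: (addrI (pure x 0)); rewrite -Dr !addr0.
Qed.

Lemma pure_sumr (I : Type) (r : seq I) (x : N) (y : I -> M) :
  pure x (\sum_(i <- r) y i) = \sum_(i <- r) pure x (y i).
Proof.
have [_ Dr _] := @pure_balanced R N M.
exact: (big_morph _ (Dr x) (pure0r x)).
Qed.

Lemma tensor_of_sum (I : Type) (r : seq I) (x : I -> N) (y : I -> M) :
  \sum_(i <- r) pure (x i) (y i) = tensor_of [seq (x i, y i) | i <- r].
Proof.
elim: r => [|i r IHr]; first by rewrite big_nil.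
by rewrite big_cons IHr [LHS]tensor_of_cat.
Qed.

Lemma tensor_expand (u : tensor N M) :
  exists L (x : 'I_L -> N) (y : 'I_L -> M), u = \sum_l pure (x l) (y l).
Proof.
exists (size (repr u)), (fun l => (tnth (in_tuple (repr u)) l).1),
  (fun l => (tnth (in_tuple (repr u)) l).2).
rewrite -(big_tnth _ _ (repr u) predT (fun z => pure z.1 z.2)) tensor_of_sum.
by rewrite (eq_map (g := id)) ?map_id ?tensor_ofK // => -[].
Qed.

End PureTensors.

Section TensorVanish.
Variables (R : comPzRingType) (N M : lmodType R).
Hypothesis flatM : equationally_flat M.

(** In this section a list over [N * 'rV[R]_k] stands for an element of
    [N (x) R^k], which [w] maps to [N (x) M]; its coordinates in [N^k] are
    given by [coord_sum]. *)
Definition lin_eval k (w : 'I_k -> M) (s : seq (N * 'rV[R]_k)) : seq (N * M) :=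
  [seq (u.1, mxact u.2 w 0) | u <- s].

Definition coord_sum k (s : seq (N * 'rV[R]_k)) (j : 'I_k) : N :=
  \sum_(u <- s) u.2 0 j *: u.1.

Definition change_coord k l (E : 'M[R]_(k, l)) (s : seq (N * 'rV[R]_k)) :=
  [seq (u.1, u.2 *m E) | u <- s].

Lemma lin_eval_change k l (E : 'M[R]_(k, l)) w s :
  lin_eval w (change_coord E s) = lin_eval (mxact E w) s.
Proof.
by rewrite /lin_eval /change_coord -map_comp; apply: eq_map => u /=; rewrite mxactM.
Qed.

Lemma change_coordM k l q (E : 'M[R]_(k, l)) (F : 'M_(l, q)) s :
  change_coord F (change_coord E s) = change_coord (E *m F) s.
Proof.
by rewrite /change_coord -map_comp; apply: eq_map => u /=; rewrite mulmxA.
Qed.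

Lemma coord_sum_change k l (E : 'M[R]_(k, l)) s j :
  coord_sum (change_coord E s) j = \sum_i E i j *: coord_sum s i.
Proof.
rewrite /coord_sum /change_coord big_map.
under [RHS]eq_bigr do rewrite scaler_sumr.
rewrite exchange_big; apply: eq_bigr => u _; rewrite mxE scaler_suml.
by apply: eq_bigr => i _; rewrite scalerA mulrC.
Qed.

Lemma coord_sum_cat k (s t : seq (N * 'rV[R]_k)) j :
  coord_sum (s ++ t) j = coord_sum s j + coord_sum t j.
Proof. by rewrite /coord_sum big_cat. Qed.

(** A concrete form of equality in [N (x) M]: the two sums come from equal
    elements of [N (x) R^k] through some linear map [R^k -> M]. *)
Definition lift_eq (s t : seq (N * M)) : Prop :=
  exists k (w : 'I_k -> M) s' t',
    [/\ s = lin_eval w s', t = lin_eval w t' & coord_sum s' = coord_sum t'].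

(** The two descriptions of the list impose one linear relation on
    [join_fam v w] per entry. Flatness makes these relations trivial one after
    the other, each time replacing [x] by a family it comes from. *)
Lemma common_coord k l (v : 'I_k -> M) (w : 'I_l -> M) s t :
  lin_eval v s = lin_eval w t ->
  exists q (x : 'I_q -> M) (E : 'M_(k, q)) (F : 'M_(l, q)),
    [/\ v = mxact E x, w = mxact F x & change_coord E s = change_coord F t].
Proof.
elim: s t => [|[n c] s IHs] [|[n' d] t] //=.
  move=> _; exists (k + l)%N, (join_fam v w), (row_mx 1%:M 0), (row_mx 0 1%:M).
  by split=> //; apply/funext=> i;
    rewrite mxact_row mxact1 mxact0 ?addr0 ?add0r.
case=> <- cd /IHs[q [x [E [F [vE wF st]]]]].
have /flatM[h [C [y [xC EC]]]] : mxact (c *m E - d *m F) x 0 = 0.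
  by rewrite mxactB !mxactM -vE -wF cd subrr.
exists h, y, (E *m C), (F *m C); split; first by rewrite mxactM -xC.
  by rewrite mxactM -xC.
rewrite /= !mulmxA; congr ((_, _) :: _).
  by apply/eqP; rewrite -subr_eq0 -mulmxBl EC.
by rewrite -/(change_coord _ _) -!change_coordM st.
Qed.

Lemma lin_eval_surj s :
  exists k (w : 'I_k -> M) (s' : seq (N * 'rV[R]_k)), s = lin_eval w s'.
Proof.
elim: s => [|[n m] s [k [w [s' ->]]]]; first by exists 0%N, (fun=> 0), [::].
exists (1 + k)%N, (join_fam (fun=> m) w),
  ((n, row_mx 1%:M 0) :: change_coord (row_mx 0 1%:M) s').
rewrite /= -/(lin_eval _ (change_coord _ _)) lin_eval_change.
rewrite mxact_row mxact1 mxact0 addr0; congr (_ :: lin_eval _ _).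
by apply/funext=> i; rewrite mxact_row mxact1 mxact0 add0r.
Qed.

(** Each generator of the congruence is checked directly; only transitivity
    needs [M] to be flat, in order to compare two coordinate systems for the
    middle term. *)
Lemma tensor_eq_lift s t : tensor_eq s t -> lift_eq s t.
Proof.
elim=> {s t}.
- by move=> s; have [k [w [s' ->]]] := lin_eval_surj s; exists k, w, s', s'.
- by move=> s t _ [k [w [s' [t' [-> -> e]]]]]; exists k, w, t', s'.
- move=> s t u _ [k [v [s' [t' [-> -> e]]]]] _ [l [w [t2 [u' [tE -> e']]]]].
  have [q [x [E [F [vE wF st]]]]] := common_coord tE.
  exists q, x, (change_coord E s'), (change_coord F u').
  split; rewrite ?lin_eval_change -?vE -?wF //; apply/funext=> j.
  rewrite coord_sum_change e -coord_sum_change st coord_sum_change e'.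
  by rewrite -coord_sum_change.
- move=> s s' t t' _ [k [v [s1 [s1' [-> -> e]]]]] _ [l [w [t1 [t1' [-> -> e']]]]].
  pose E : 'M[R]_(k, k + l) := row_mx 1%:M 0.
  pose F : 'M[R]_(l, k + l) := row_mx 0 1%:M.
  have vE : v = mxact E (join_fam v w).
    by apply/funext=> i; rewrite mxact_row mxact1 mxact0 addr0.
  have wF : w = mxact F (join_fam v w).
    by apply/funext=> i; rewrite mxact_row mxact1 mxact0 add0r.
  exists (k + l)%N, (join_fam v w), (change_coord E s1 ++ change_coord F t1),
    (change_coord E s1' ++ change_coord F t1').
  split; last 1 first.
  + apply/funext=> j; rewrite !coord_sum_cat !coord_sum_change.
    by rewrite e e'.
  + by rewrite [RHS]map_cat -!/(lin_eval _ _) !lin_eval_change -vE -wF.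
  + by rewrite [RHS]map_cat -!/(lin_eval _ _) !lin_eval_change -vE -wF.
- move=> s t; have [k [w [u stE]]] := lin_eval_surj (s ++ t).
  exists k, w, u, (drop (size s) u ++ take (size s) u).
  split=> //; last first.
    apply/funext=> j; rewrite coord_sum_cat addrC -coord_sum_cat.
    by rewrite cat_take_drop.
  rewrite /lin_eval map_cat map_take map_drop -/(lin_eval w u) -stE.
  by rewrite take_size_cat // drop_size_cat.
- move=> y; exists 1%N, (fun=> y), [:: (0, 1%:M)], [::].
  split=> //; first by rewrite /= mxact1.
  by apply/funext=> j; rewrite /coord_sum big_seq1 big_nil scaler0.
- move=> x x' y; exists 1%N, (fun=> y), [:: (x + x', 1%:M)],
    [:: (x, 1%:M); (x', 1%:M)].
  split; rewrite /= ?mxact1 //.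
  by apply/funext=> j; rewrite /coord_sum !big_cons !big_nil /= !addr0 scalerDr.
- move=> x y y'.
  pose a : 'rV[R]_(1 + 1) := row_mx 1%:M 0.
  pose b : 'rV[R]_(1 + 1) := row_mx 0 1%:M.
  exists (1 + 1)%N, (join_fam (fun=> y) (fun=> y')),
    [:: (x, row_mx 1%:M 1%:M)], [:: (x, a); (x, b)].
  split; rewrite /= ?mxact_row ?mxact1 ?mxact0 ?add0r ?addr0 //.
  apply/funext=> j; rewrite /coord_sum !big_cons !big_nil /= !addr0 -scalerDl.
  have <- : a + b = row_mx 1%:M 1%:M by rewrite add_row_mx addr0 add0r.
  by rewrite mxE.
- move=> a x y; exists 1%N, (fun=> y), [:: (a *: x, 1%:M)], [:: (x, a%:M)].
  split; rewrite /= ?mxact1 //.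
    by rewrite /mxact big_ord1 mxE.
  by apply/funext=> j; rewrite /coord_sum !big_seq1 /= !ord1 !mxE !mulr1n scale1r.
Qed.

(** A form of [tensor_eq_lift] with the empty sum on one side. Flatness is
    what makes it hold for an arbitrary family [x], where the general criterion
    asks that [x] generate [N]. *)
Lemma tensor_vanish (I : finType) (x : I -> N) (y : I -> M) :
  \sum_i pure (x i) (y i) = 0 ->
  exists k (c : I -> 'rV[R]_k) (w : 'I_k -> M),
    (forall i, y i = mxact (c i) w 0) /\ forall j, \sum_i c i 0 j *: x i = 0.
Proof.
rewrite tensor_of_sum => /tensor_ofP/tensor_eq_lift[k [w [s [t []]]]].
case: t => [|//] sE _ s0; exists k.
pose u i := nth (0, 0) s (index i (index_enum I)).
have szs : size s = size (index_enum I).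
  by rewrite -(size_map (fun i => (x i, y i))) sE size_map.
have s_u i : (x i, y i) = ((u i).1, mxact (u i).2 w 0).
  have i_lt : (index i (index_enum I) < size (index_enum I))%N.
    by rewrite index_mem mem_index_enum.
  have := congr1 (fun z => nth (0, 0) z (index i (index_enum I))) sE.
  rewrite (nth_map i) // nth_index ?mem_index_enum //.
  by rewrite (nth_map (0, 0)) ?szs.
exists (fun i => (u i).2), w; split=> [i|j]; first by case: (s_u i).
have := congr1 (fun g => g j) s0; rewrite /coord_sum big_nil => s0j.
rewrite -[RHS]s0j.
suff -> : s = [seq u i | i <- index_enum I].
  by rewrite big_map; apply: eq_bigr => i _; case: (s_u i) => ->.
apply: (@eq_from_nth _ (0, 0)) => [|q q_lt]; first by rewrite size_map.
rewrite szs in q_lt; have [i0 _] : exists i0 : I, True.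
  by move: q_lt; case: (index_enum I) => [//|i0 ? _]; exists i0.
by rewrite (nth_map i0) // /u index_uniq // index_enum_uniq.
Qed.

End TensorVanish.

(** * Flat modules are equationally flat *)

Lemma tensor_map_balanced (R : comPzRingType) (L L' M : lmodType R)
    (f : {linear L -> L'}) : balanced (fun x (y : M) => pure (f x) y).
Proof.
have [Dl Dr Z] := @pure_balanced R L' M.
by split=> [x x' y|x y y'|a x y];
  [rewrite raddfD Dl | exact: Dr | rewrite linearZ Z].
Qed.

(** The ideal generated by the entries of [a] as a module of its own, so that
    flatness can be tested on its inclusion in [R]. *)
Section RowIdeal.
Variables (R : comPzRingType) (n : nat) (a : 'rV[R]_n).

Definition row_ideal_pred (x : R^o) : bool :=
  `[< exists c : 'cV[R]_n, x = (a *m c) 0 0 >].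

Lemma row_ideal_submod_closed : submod_closed row_ideal_pred.
Proof.
split=> [|b x y /asboolP[c ->] /asboolP[d ->]]; apply/asboolP.
  by exists 0; rewrite mulmx0 mxE.
by exists (b *: c + d); rewrite mulmxDr -scalemxAr !mxE.
Qed.

HB.instance Definition _ :=
  GRing.isSubmodClosed.Build R R^o row_ideal_pred row_ideal_submod_closed.

Definition row_ideal : Type := {x : R^o | row_ideal_pred x}.
HB.instance Definition _ := Choice.on row_ideal.
HB.instance Definition _ := SubType.copy row_ideal {x : R^o | row_ideal_pred x}.
HB.instance Definition _ := [SubChoice_isSubLmodule of row_ideal by <:].

End RowIdeal.

(** The universal property of the tensor product for maps to the quotient of
    [G] by the subgroup [P], stated without forming that quotient. *)
Lemma tensor_eq_mod (R : comPzRingType) (L M : lmodType R) (G : zmodType)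
    (P : G -> Prop) (h : L -> M -> G) :
    P 0 -> (forall u v, P u -> P v -> P (u - v)) ->
    (forall x x' y, P (h (x + x') y - (h x y + h x' y))) ->
    (forall x y y', P (h x (y + y') - (h x y + h x y'))) ->
    (forall a x y, P (h (a *: x) y - h x (a *: y))) ->
  forall s t, tensor_eq s t ->
    P (\sum_(u <- s) h u.1 u.2 - \sum_(u <- t) h u.1 u.2).
Proof.
move=> P0 PB hDl hDr hZ.
have PN u : P u -> P (- u) by move=> Pu; rewrite -sub0r; apply: PB.
have PD u v : P u -> P v -> P (u + v).
  by move=> Pu Pv; rewrite -[v]opprK; apply: PB => //; apply: PN.
move=> s t; elim=> {s t}.
- by move=> s; rewrite subrr.
- by move=> s t _ IH; rewrite -opprB; apply: PN.
- by move=> s t u _ IH1 _ IH2; rewrite -(subrK (\sum_(x <- t) h x.1 x.2)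
    (\sum_(x <- s) h x.1 x.2)) -addrA; apply: PD.
- by move=> s s' t t' _ IH1 _ IH2; rewrite !big_cat /= opprD addrACA; apply: PD.
- by move=> s t; rewrite !big_cat /= addrC subrr.
- move=> y; rewrite big_seq1 big_nil subr0 /=.
  by have /PN := hDl 0 0 y; rewrite addr0 opprB addrK.
- by move=> x x' y; rewrite !big_cons !big_nil !addr0 /=; apply: hDl.
- by move=> x y y'; rewrite !big_cons !big_nil !addr0 /=; apply: hDr.
- by move=> a x y; rewrite !big_seq1 /=; apply: hZ.
Qed.

Section FlatEquational.
Variables (R : comPzRingType) (M : lmodType R) (n : nat) (a : 'rV[R]_n).

Local Notation family := ('I_n -> M : lmodType R).
Local Notation trivial := (@trivial_relation R M n a).

Lemma trivial_relation0 : trivial (0 : family).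
Proof. by exists 0%N, 0, (fun=> 0); rewrite mxact0 mulmx0. Qed.

Lemma trivial_relationB (u v : family) :
  trivial u -> trivial v -> trivial (u - v).
Proof.
move=> [k [C [w [-> aC]]]] [l [D [x [-> aD]]]].
exists (k + l)%N, (row_mx C (- D)), (join_fam w x); split.
  apply/funext=> i; rewrite mxact_row; congr (_ + _).
  by rewrite -[- D]sub0r mxactB mxact0 sub0r.
by rewrite mul_mx_row mulmxN aC aD oppr0 row_mx0.
Qed.

Lemma trivial_relationD (u v : family) :
  trivial u -> trivial v -> trivial (u + v).
Proof.
move=> tu tv; rewrite -[v]opprK; apply: trivial_relationB => //.
by rewrite -[- v]add0r; apply: trivial_relationB => //; apply: trivial_relation0.
Qed.

Lemma trivial_relation_sum (I : Type) (r : seq I) (u : I -> family) :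
  (forall i, trivial (u i)) -> trivial (\sum_(i <- r) u i).
Proof.
move=> triv_u; elim/big_ind: _ => //; first exact: trivial_relation0.
exact: trivial_relationD.
Qed.

Lemma trivial_relation_col (d : 'cV[R]_n) (m : M) :
  a *m d = 0 -> trivial (fun i => d i 0 *: m).
Proof.
move=> ad; exists 1%N, d, (fun=> m); split=> //.
by apply/funext=> i; rewrite /mxact big_ord1.
Qed.

Lemma row_idealP (x : row_ideal a) : exists c : 'cV[R]_n, val x = (a *m c) 0 0.
Proof. by have /asboolP := valP x. Qed.

(** A choice of coordinates, linear only up to relations of [a]. *)
Definition row_ideal_coord (x : row_ideal a) : 'cV[R]_n :=
  sval (cid (row_idealP x)).

Lemma row_ideal_coordE x : a *m row_ideal_coord x = (val x)%:M.
Proof.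
rewrite /row_ideal_coord; case: cid => c /= ->.
exact: mx11_scalar.
Qed.

(** Let [I] be the ideal generated by [a]. By flatness [\sum_i a_i (x) m_i]
    vanishes in [I (x) M], since it does in [R (x) M]. Sending [x (x) y] to
    the coordinates of [x] times [y] is well defined from [I (x) M] to the
    families of [M] modulo trivial relations, because the coordinates of [x]
    are determined up to relations of [a]; the tensor above is sent to the
    class of [m]. *)
Lemma flat_module_trivial (m : 'I_n -> M) :
  flat_module M -> mxact a m 0 = 0 -> trivial m.
Proof.
move=> flatM am0.
have aI i : row_ideal_pred a (a 0 i).
  apply/asboolP; exists (delta_mx i 0).
  by rewrite -colE mxE.
pose e i : row_ideal a := Sub (a 0 i) (aI i).
pose v : {linear row_ideal a -> R^o} := val.
have tensor0 : \sum_i pure (e i) (m i) = 0.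
  apply: (flatM _ _ v val_inj).
  have balv := tensor_map_balanced M v; have [Dl Dr Z] := @pure_balanced R R^o M.
  rewrite /tensor_map (tensor_lift0 balv) tensor_of_sum (tensor_lift_of balv).
  rewrite big_map /=.
  under eq_bigr => i _ do rewrite -[a 0 i]mulr1 -[_ * 1]/(a 0 i *: (1 : R^o)) Z.
  by rewrite -pure_sumr -/(mxact a m 0) am0 pure0r.
move: tensor0; rewrite tensor_of_sum => /tensor_ofP.
pose h (x : row_ideal a) (y : M) : family := fun i => row_ideal_coord x i 0 *: y.
move/(@tensor_eq_mod _ _ _ _ trivial h trivial_relation0 trivial_relationB).
rewrite big_nil subr0 big_map /= => triv.
suff : trivial (\sum_i h (e i) (m i)).
  (* The i-th unit vector and the chosen coordinates of a_i differ by a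
     relation of a. *)
  have mE : m = \sum_i (fun j => (delta_mx i 0 - row_ideal_coord (e i)) j 0 *: m i)
     + \sum_i h (e i) (m i).
    rewrite -big_split fct_sumE; apply/funext=> j /=.
    rewrite (bigD1 j) //= big1 => [|i /negPf ij];
      rewrite addrfctE /h -scalerDl !mxE.
      by rewrite !eqxx subrK scale1r addr0.
    by rewrite eq_sym ij sub0r addNr scale0r.
  move=> triv_h; rewrite mE; apply: trivial_relationD => //.
  apply: trivial_relation_sum => i; apply: trivial_relation_col.
  rewrite mulmxBr row_ideal_coordE -colE [col i a]mx11_scalar mxE.
  exact: subrr.
apply: triv => [x x' y|x y y'|b x y].
- have -> : h (x + x') y - (h x y + h x' y) =
    (fun i => (row_ideal_coord (x + x') - row_ideal_coord x -
               row_ideal_coord x') i 0 *: y).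
    by apply/funext=> i; rewrite /h !mxE !scalerDl !scaleNr -addrA -opprD.
  apply: trivial_relation_col; rewrite !mulmxBr !row_ideal_coordE.
  by rewrite (raddfD v) raddfD /= addrAC addrK subrr.
- have -> : h x (y + y') - (h x y + h x y') = 0.
    by apply/funext=> i; rewrite /h addrfctE opprfctE addrfctE scalerDr subrr.
  exact: trivial_relation0.
- have -> : h (b *: x) y - h x (b *: y) =
    (fun i => (row_ideal_coord (b *: x) - b *: row_ideal_coord x) i 0 *: y).
    apply/funext=> i; rewrite addrfctE opprfctE /h !mxE scalerDl scaleNr.
    by rewrite scalerA mulrC.
  apply: trivial_relation_col; rewrite mulmxBr -scalemxAr !row_ideal_coordE.
  by rewrite (linearZ_LR v) scale_scalar_mx subrr.
Qed.

End FlatEquational.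

Lemma flat_module_equational (R : comPzRingType) (M : lmodType R) :
  flat_module M -> equationally_flat M.
Proof. by move=> flatM n a m; apply: flat_module_trivial. Qed.

(** * Separating tensors of weakly etale maps *)

Section Diagonal.
Variables (R S : comPzRingType) (f : {rmorphism R -> S}).

Definition tsq (x y : S) : tensor_sq f := @pure R (restrict f) (restrict f) x y.

Definition equalizes (e : tensor_sq f) (s : S) : Prop :=
  tsq s 1 * e = tsq 1 s * e.

(** A local form of separability: an [e] that worked for all [s] at once would
    be a separability idempotent. *)
Definition locally_separated : Prop :=
  forall n (s : 'I_n -> S), exists e : tensor_sq f,
    mult_map e = 1 /\ forall i, equalizes e (s i).

Lemma tsqM x y x' y' : tsq x y * tsq x' y' = tsq (x * x') (y * y').
Proof. exact: tsq_mul_pure. Qed.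

Lemma mult_tsq x y : mult_map (tsq x y) = x * y.
Proof. exact: mult_map_pure. Qed.

(** Over [S (x) S] the relation [(s (x) 1 - 1 (x) s) *: 1 = 0] in the flat
    module [S] is trivial: [1] is a combination of products of tensors killed
    by [s (x) 1 - 1 (x) s]. *)
Lemma flat_mult_separator (s : S) :
  flat_map (@mult_map R S f) ->
  exists e : tensor_sq f, mult_map e = 1 /\ equalizes e s.
Proof.
move=> /flat_module_equational flatT.
pose u := tsq s 1 - tsq 1 s.
have [|k [C [w [oneE uC]]]] := flatT 1%N u%:M (fun=> 1).
  rewrite /mxact big_ord1 mxE eqxx mulr1n [LHS]restrict_scaleE mulr1.
  by rewrite /u raddfB /= !mult_tsq mulr1 mul1r subrr.
exists (\sum_j C 0 j * tsq 1 (w j)); split.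
  rewrite raddf_sum.
  transitivity (\sum_j mult_map (C 0 j) * w j).
    apply: eq_bigr => j _.
    by rewrite [LHS](rmorphM (@mult_map R S f)) /= mult_tsq mul1r.
  by have := congr1 (fun g => g 0) oneE.
apply/eqP; rewrite -subr_eq0 -mulrBl -/u mulr_sumr big1 // => j _.
have := congr1 (fun A : 'M_(1, k) => A 0 j) uC.
by rewrite mul_scalar_mx !mxE mulrA => ->; rewrite mul0r.
Qed.

Lemma flat_mult_locally_separated :
  flat_map (@mult_map R S f) -> locally_separated.
Proof.
move=> flatT n s.
have [e sep_e] := choice (fun i => flat_mult_separator (s i) flatT).
exists (\prod_i e i); split=> [|i].
  by rewrite rmorph_prod big1 // => j _; case: (sep_e j).
by rewrite /equalizes (bigD1 i) //= !mulrA; case: (sep_e i) => _ ->.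
Qed.

End Diagonal.

(** * Coherence in terms of relations *)

Section Coherent.
Variable R : comPzRingType.

Definition fin_gen_relations : Prop :=
  forall n (a : 'cV[R]_n), exists q (G : 'M_(q, n)),
    G *m a = 0 /\ forall c : 'rV_n, c *m a = 0 -> exists y, c = y *m G.

Lemma linear_rowE n (f : {linear 'rV[R]_n -> R^o}) v :
  (v *m \col_j f (delta_mx 0 j)) 0 0 = f v.
Proof.
rewrite [in RHS](row_sum_delta v) linear_sum mxE; apply: eq_bigr => j _.
by rewrite mxE linearZ.
Qed.

(** Coherence presents the ideal [I] of [a] by some generators [b] with
    relations generated by the rows of [G], whereas relations between the given
    generators [a] are wanted. Writing [a = P b] and [b = Q a], a relation [c]
    of [a] is [c (1 - P Q) + (c P) Q], and [c P] is a relation of [b]: the rows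
    of [1 - P Q] and of [G Q] generate. *)
Lemma coherent_fin_gen_relations : coherent_ring R -> fin_gen_relations.
Proof.
move=> cohR n a.
pose I : set R^o :=
  [set x | exists c : 'I_n -> R, x = \sum_(i < n) c i *: (a i 0 : R^o)].
have [|m [f [fI [k [g gker]]]]] := cohR I; first by exists n, (fun i => a i 0).
pose b := \col_j (f (delta_mx 0 j) : R).
have fE (v : 'rV_m) : (v *m b) 0 0 = f v by exact: linear_rowE.
have /choice[p pE] i : exists p, f p = a i 0.
  have : I (a i 0).
    exists (fun j => (j == i)%:R).
    rewrite (bigD1 i) //= big1 ?addr0 ?eqxx ?scale1r //.
    by move=> j /negPf ->; rewrite scale0r.
  by rewrite -fI => -[p _ pE]; exists p.
have /choice[q qE] j : exists q : 'I_n -> R, b j 0 = \sum_i q i * a i 0.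
  have : I (b j 0) by rewrite -fI mxE; exists (delta_mx 0 j).
  by case=> q qE; exists q.
pose P := \matrix_(i, j) p i 0 j; pose Q := \matrix_(j, i) q j i.
have Pb : P *m b = a.
  apply/matrixP=> i j; rewrite ord1 -pE -fE !mxE.
  by apply: eq_bigr => l _; rewrite !mxE.
have Qa : Q *m a = b.
  apply/matrixP=> i j; rewrite ord1 qE mxE.
  by apply: eq_bigr => l _; rewrite mxE.
pose G := lin1_mx g.
exists (n + k)%N, (col_mx (1%:M - P *m Q) (G *m Q)); split.
  rewrite mul_col_mx mulmxBl mul1mx -!mulmxA Qa Pb subrr.
  suff -> : G *m b = 0 by rewrite col_mx0.
  apply/row_matrixP=> i; rewrite row_mul row0; apply/matrixP=> s t.
  rewrite !ord1 fE mxE.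
  have : range g (g (delta_mx 0 i)) by exists (delta_mx 0 i).
  by rewrite gker -mul_rV_lin1 -rowE.
move=> c ca.
have : f (c *m P) = 0 by rewrite -fE -mulmxA Pb ca mxE.
rewrite -[_ = 0]/([set v | f v = 0] (c *m P)) -gker => -[y _ yE].
exists (row_mx c y); rewrite mul_row_col mulmxBr mulmx1 !mulmxA.
by rewrite mul_rV_lin1 yE subrK.
Qed.

Lemma fin_gen_relations_coherent : fin_gen_relations -> coherent_ring R.
Proof.
move=> relR I [n [g IE]].
pose a := \col_i (g i : R).
pose f (v : 'rV[R]_n) : R^o := (v *m a) 0 0.
have fL : linear f by move=> b u v; rewrite /f mulmxDl -scalemxAl !mxE.
pose fl : {linear 'rV[R]_n -> R^o} :=
  HB.pack f (GRing.isLinear.Build _ _ _ _ f fL).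
have [q [G [Ga relG]]] := relR n a.
exists n, fl; split.
  rewrite IE; apply/seteqP; split=> x /=.
    move=> [v _ <-]; exists (fun i => v 0 i); rewrite /f mxE.
    by apply: eq_bigr => i _; rewrite mxE.
  move=> [c ->]; exists (\row_i c i) => //; rewrite /f mxE.
  by apply: eq_bigr => i _; rewrite !mxE.
exists q, (mulmxr G); apply/seteqP; split=> v /=.
  by move=> [y _ <-]; rewrite /f /= -mulmxA Ga mulmx0 mxE.
move=> fv0; have [|y ->] := relG v; last by exists y.
by apply/matrixP=> i j; rewrite !ord1 [RHS]mxE; exact: fv0.
Qed.

End Coherent.

(** * Ascent of coherence along weakly etale maps *)

(** Chase: a relation [a] holds in [K -> M] as soon as it holds at each point
    of [K]. There it is trivial, through coefficients which depend on the point
    but are combinations of the same finitely many generators [G] of the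
    relations of [a]. *)
Lemma equationally_flat_prod (R : comPzRingType) (M : lmodType R) (K : Type) :
  fin_gen_relations R -> equationally_flat M -> equationally_flat (K -> M).
Proof.
move=> relR flatM n a m am0.
have [q [G [Ga relG]]] := relR n a^T.
have /choice[w wE] (t : K) : exists w : 'I_q -> M, m^~ t = mxact G^T w.
  have [|k [C [w [mE aC]]]] := flatM n a (m^~ t).
    by have := congr1 (fun h => h t) am0; rewrite /mxact fct_sumE.
  have /choice[Y YE] j : exists y, row j C^T = y *m G.
    by apply: relG; rewrite -row_mul -trmx_mul aC trmx0 row0.
  exists (mxact (\matrix_j Y j)^T w); rewrite -mxactM -trmx_mul mE; congr mxact.
  rewrite -[LHS]trmxK; congr trmx; apply/row_matrixP=> j.
  by rewrite row_mul rowK YE.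
exists q, G^T, (fun j t => w t j); split.
  apply/funext=> i; apply/funext=> t; rewrite /mxact fct_sumE.
  by have := congr1 (fun h => h i) (wE t).
by rewrite -[LHS]trmxK trmx_mul trmxK Ga trmx0.
Qed.

Section Ascent.
Variables (R S : comPzRingType) (g : {rmorphism R -> S}).
Hypotheses (flat_g : equationally_flat (restrict g)).
Hypothesis (sep_g : locally_separated g).
Hypothesis (relR : fin_gen_relations R).

(** The family [m] of coordinate functions on the set [K] of all relations of
    [b] satisfies [\sum_i b_i m_i = 0]. The tensor [e] and [R]-flatness of
    [M = S^K] make this relation trivial over [S], and evaluating the resulting
    expression of [m] at [c \in K] writes [c] as a combination of finitely many
    relations of [b]. *)
Lemma weakly_etale_fin_gen_relations : fin_gen_relations S.
Proof.
move=> n b.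
pose K := {c : 'rV[S]_n | c *m b = 0}.
pose M : lmodType R := (K -> restrict g).
have flatM : equationally_flat M by exact: equationally_flat_prod.
pose B i : restrict g := b i 0.
pose m i : M := fun t : K => sval t 0 i.
pose act (y : S) (x : M) : M := fun t => (y : restrict g) * x t.
have bm0 : \sum_i act (B i) (m i) = 0.
  apply/funext=> t; rewrite fct_sumE /act /m.
  have := congr1 (fun A : 'M_1 => A 0 0) (svalP t); rewrite !mxE; apply: etrans.
  by apply: eq_bigr => i _; rewrite mulrC.
have [e [mult_e eq_e]] := sep_g (fun i => b i 0).
have [L [x [y eE]]] := tensor_expand e.
have xy1 : \sum_l (x l : S) * y l = 1.
  by rewrite -mult_e eE raddf_sum; apply: eq_bigr => l _; rewrite [RHS]mult_tsq.
(* This is the sum of the b_i e (1 (x) m_i); moving b_i across e turns it into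
   e (1 (x) \sum_i b_i m_i). *)
have pure_act0 :
    \sum_(p : 'I_n * 'I_L) pure (B p.1 * x p.2) (act (y p.2) (m p.1)) = 0.
  rewrite -(pair_bigA _ (fun i l =>
    pure (B i * x l) (act (y l) (m i)))) /=.
  transitivity (\sum_i \sum_l pure (x l) (act (y l) (act (B i) (m i)))).
    apply: eq_bigr => i _.
    pose pure_m (z z' : restrict g) := pure z (act z' (m i)).
    pose phi (u : tensor_sq g) := tensor_lift pure_m u.
    have phi_bal : balanced pure_m.
      have [Dl Dr Z] := @pure_balanced R (restrict g) M.
      split=> [z z' u|z u u'|c z u]; first exact: Dl.
        by rewrite -Dr /pure_m; congr pure; apply/funext=> t; exact: mulrDl.
      by rewrite /pure_m Z; congr pure; apply/funext=> t; rewrite [RHS]/act -mulrA.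
    have phiE (u : restrict g) (v : S) :
        phi (tsq g u v * e) = \sum_l pure (u * x l) (act (v * y l) (m i)).
      rewrite eE mulr_sumr /phi.
      rewrite (big_morph _ (tensor_liftD phi_bal) (tensor_lift0 phi_bal)).
      apply: eq_bigr => l _.
      by rewrite [X in tensor_lift _ X]tsqM (tensor_lift_pure phi_bal).
    have := congr1 phi (eq_e i); rewrite !phiE => bE.
    transitivity (\sum_l pure (B i * x l) (act (1 * y l) (m i))).
      by apply: eq_bigr => l _; rewrite mul1r.
    rewrite bE; apply: eq_bigr => l _; rewrite mul1r.
    by congr pure; apply/funext=> t; rewrite /act mulrCA mulrA.
  rewrite exchange_big big1 // => l _; rewrite -pure_sumr.
  rewrite (_ : \sum_i _ = 0) ?pure0r //; apply/funext=> t; rewrite fct_sumE.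
  have := congr1 (fun h => (y l : restrict g) * h t) bm0.
  by rewrite fct_sumE mulr_sumr mulr0.
have [k [c [w [yE cx]]]] := tensor_vanish flatM pure_act0.
exists k, (\matrix_(j, i) \sum_l g (c (i, l) 0 j) * x l); split.
  apply/matrixP=> j j0; rewrite !ord1 !mxE.
  rewrite -[RHS](cx j).
  rewrite [RHS](eq_bigr (fun p => c (p.1, p.2) 0 j *: (B p.1 * x p.2)));
    last by case.
  rewrite -(pair_bigA _ (fun i l => c (i, l) 0 j *: (B i * x l))) /=.
  apply: eq_bigr => i _; rewrite mxE mulr_suml; apply: eq_bigr => l _.
  by rewrite -mulrA [x l * _]mulrC.
move=> r rb; pose t : K := exist _ r rb.
exists (\row_j (w j t : S)); apply/rowP=> i; rewrite mxE.
transitivity (\sum_l (x l : S) * (act (y l) (m i)) t).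
  rewrite /act -[LHS]mul1r -xy1 mulr_suml.
  by apply: eq_bigr => l _; rewrite mulrA.
under [RHS]eq_bigr do rewrite !mxE mulr_sumr.
rewrite exchange_big; apply: eq_bigr => l _.
rewrite (yE (i, l)) /mxact fct_sumE mulr_sumr; apply: eq_bigr => j _.
by rewrite [(_ *: _) t]restrict_scaleE mulrA mulrC; congr (_ * _); rewrite mulrC.
Qed.

End Ascent.

(** * Weakly etale maps and colimits *)

Section BaseChange.
Variables (R S R' S' : comPzRingType).
Variables (f : {rmorphism R -> S}) (f' : {rmorphism R' -> S'}).
Variables (h : {rmorphism R -> R'}) (k : {rmorphism S -> S'}).
Hypothesis square : forall a, k (f a) = f' (h a).

Definition tsq_map (u : tensor_sq f) : tensor_sq f' :=
  tensor_lift (fun x y : restrict f => tsq f' (k x) (k y)) u.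

Lemma tsq_map_balanced :
  balanced (fun x y : restrict f => tsq f' (k x) (k y)).
Proof.
have [Dl Dr Z] := @pure_balanced R' (restrict f') (restrict f').
split=> [x x' y|x y y'|a x y]; rewrite /tsq ?rmorphD ?Dl ?Dr //.
rewrite !restrict_scaleE !rmorphM square.
by rewrite -[_ * k x]/(h a *: (k x : restrict f')) Z.
Qed.

Lemma tsq_map_tsq x y : tsq_map (tsq f x y) = tsq f' (k x) (k y).
Proof. exact: (tensor_lift_pure tsq_map_balanced). Qed.

Lemma tsq_mapD u v : tsq_map (u + v) = tsq_map u + tsq_map v.
Proof. exact: (tensor_liftD tsq_map_balanced). Qed.

Lemma tsq_map0 : tsq_map 0 = 0.
Proof. exact: (tensor_lift0 tsq_map_balanced). Qed.

Lemma tsq_map_mul x y u :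
  tsq_map (tsq f x y * u) = tsq f' (k x) (k y) * tsq_map u.
Proof.
elim/tensor_ind: u => [|x' y'|u v IHu IHv]; first by rewrite mulr0 tsq_map0 mulr0.
  by rewrite -/(tsq f x' y') tsqM !tsq_map_tsq tsqM !rmorphM.
by rewrite mulrDr !tsq_mapD IHu IHv mulrDr.
Qed.

Lemma mult_tsq_map u : mult_map (tsq_map u) = k (mult_map u).
Proof.
elim/tensor_ind: u => [|x y|u v IHu IHv]; first by rewrite tsq_map0 !raddf0.
  by rewrite -/(tsq f x y) tsq_map_tsq !mult_tsq rmorphM.
by rewrite tsq_mapD !raddfD /= IHu IHv.
Qed.

Lemma equalizes_tsq_map e s : equalizes e s -> equalizes (tsq_map e) (k s).
Proof.
by move=> /(congr1 tsq_map); rewrite !tsq_map_mul rmorph1.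
Qed.

End BaseChange.

Section ColimitInclusion.
Variables (R : comPzRingType) (phi : {rmorphism R -> R}) (n : nat).

Lemma colim_in_is_zmod_morphism : zmod_morphism (colim_in phi n).
Proof. by move=> a b; rewrite -colim_inD -colim_inN. Qed.

Lemma colim_in_is_monoid_morphism : monoid_morphism (colim_in phi n).
Proof. by split=> [|a b]; [exact: colim_in1 | rewrite -colim_inM]. Qed.

HB.instance Definition _ :=
  GRing.isZmodMorphism.Build R (colim phi) (colim_in phi n)
    colim_in_is_zmod_morphism.
HB.instance Definition _ :=
  GRing.isMonoidMorphism.Build R (colim phi) (colim_in phi n)
    colim_in_is_monoid_morphism.

End ColimitInclusion.

Section Colimit.
Variables (R : comPzRingType) (phi : {rmorphism R -> R}).

Lemma colim_in_raise k n (x : R) :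
  colim_in phi n x = colim_in phi (n + k) (iter k phi x).
Proof. by rewrite colim_in_iter. Qed.

Lemma colim_in_family (n : nat) (x : 'I_n -> colim phi) :
  exists N (a : 'I_n -> R), forall i, x i = colim_in phi N (a i).
Proof.
pose N := \max_i (repr (x i)).1.
exists N, (fun i => iter (N - (repr (x i)).1) phi (repr (x i)).2) => i.
rewrite {1}[x i]colim_inE (colim_in_raise (N - (repr (x i)).1)) subnKC //.
exact: (leq_bigmax i).
Qed.

Lemma iter_is_rmorphism k : exists h : {rmorphism R -> R}, iter k phi =1 h.
Proof.
elim: k => [|k [h hE]]; first by exists idfun.
by exists (phi \o h) => x /=; rewrite hE.
Qed.

Lemma colim_in_eq0 n a : colim_in phi n a = 0 -> exists k, iter k phi a = 0.
Proof.
move=> /colim_inP[i [j [_ e]]]; exists i; rewrite e.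
by have [h ->] := iter_is_rmorphism j; rewrite rmorph0.
Qed.

End Colimit.

Section ColimitMap.
Variables (R S : comPzRingType).
Variables (phi : {rmorphism R -> R}) (psi : {rmorphism S -> S}).
Variable (f : {rmorphism R -> S}).
Hypothesis f_phi : forall a, f (phi a) = psi (f a).

(** The compatibility proof is an argument so that the morphism structure,
    which depends on it, can be inferred. *)
Definition colim_map of (forall a, f (phi a) = psi (f a)) := fun x : colim phi =>
  colim_in psi (repr x).1 (f (repr x).2).
Local Notation g := (colim_map f_phi).

Lemma colim_map_iter k a : f (iter k phi a) = iter k psi (f a).
Proof. by elim: k => //= k <-; rewrite f_phi. Qed.

Lemma colim_map_in n a : g (colim_in phi n a) = colim_in psi n (f a).
Proof.
have /colim_inP[i [j [e1 e2]]] := esym (colim_inE (colim_in phi n a)).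
by apply/colim_inP; exists i, j; rewrite -!colim_map_iter e1 e2.
Qed.

Lemma colim_map_is_zmod_morphism : zmod_morphism g.
Proof.
move=> x y; have [n [a [b [_ [-> -> _]]]]] := colim_common x y y.
by rewrite -(raddfB (colim_in phi n)) !colim_map_in (raddfB f) raddfB.
Qed.

Lemma colim_map_is_monoid_morphism : monoid_morphism g.
Proof.
split=> [|x y]; first by rewrite -(rmorph1 (colim_in phi 0)) colim_map_in !rmorph1.
have [n [a [b [_ [-> -> _]]]]] := colim_common x y y.
by rewrite -(rmorphM (colim_in phi n)) !colim_map_in (rmorphM f) rmorphM.
Qed.

HB.instance Definition _ :=
  GRing.isZmodMorphism.Build (colim phi) (colim psi) g
    colim_map_is_zmod_morphism.
HB.instance Definition _ :=
  GRing.isMonoidMorphism.Build (colim phi) (colim psi) g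
    colim_map_is_monoid_morphism.

Lemma colim_map_locally_separated : locally_separated f -> locally_separated g.
Proof.
move=> sep_f n s; have [N [t sE]] := colim_in_family s.
have [e [e1 eq_e]] := sep_f n t.
pose k := colim_in psi N.
have square a : k (f a) = g (colim_in phi N a) by rewrite colim_map_in.
exists (tsq_map g k e); split=> [|i].
  by rewrite (mult_tsq_map square) e1 rmorph1.
by rewrite sE; apply: (equalizes_tsq_map square).
Qed.

(** A relation in the colimit is represented at some stage, becomes an actual
    relation of [S] over [R] at a later one, and its triviality there persists
    in the colimit. *)
Lemma colim_map_equationally_flat :
  equationally_flat (restrict f) -> equationally_flat (restrict g).
Proof.
move=> flat_f n a m am0.
have [N [b aE]] := colim_in_family (a 0).
have [N' [d mE]] := colim_in_family m.
pose b' i := iter N' phi (b i); pose d' i := iter N psi (d i).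
have bN i : a 0 i = colim_in phi (N + N') (b' i) by rewrite aE -colim_in_raise.
have dN i : m i = colim_in psi (N + N') (d' i) by rewrite mE addnC -colim_in_raise.
have [k k0] : exists k, iter k psi (\sum_i f (b' i) * d' i) = 0.
  apply: (@colim_in_eq0 _ _ (N + N')); rewrite raddf_sum.
  rewrite -[RHS]am0; apply: eq_bigr => i _.
  rewrite [RHS]restrict_scaleE bN dN [X in _ = X * _]colim_map_in.
  exact: rmorphM.
have [|q [C [w [wE aC]]]] :=
    flat_f n (\row_i iter k phi (b' i)) (fun i => iter k psi (d' i)).
  rewrite -[RHS]k0 /mxact; have [h hE] := iter_is_rmorphism psi k.
  rewrite hE raddf_sum; apply: eq_bigr => i _.
  by rewrite mxE [LHS]restrict_scaleE colim_map_iter !hE -[LHS](rmorphM h).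
exists q, (map_mx (colim_in phi (N + N' + k)) C),
  (fun j => colim_in psi (N + N' + k) (w j)).
split.
  apply/funext=> i; rewrite dN (colim_in_raise _ k).
  have -> : iter k psi (d' i) = mxact C w i by rewrite -wE.
  rewrite /mxact raddf_sum; apply: eq_bigr => j _.
  rewrite [RHS]restrict_scaleE mxE [X in _ = X * _]colim_map_in.
  exact: rmorphM.
have -> : a = map_mx (colim_in phi (N + N' + k)) (\row_i iter k phi (b' i)).
  by apply/rowP=> i; rewrite !mxE bN -colim_in_raise.
by rewrite -map_mxM aC map_mx0.
Qed.

End ColimitMap.

Theorem proposition4p15 (p : nat) (A B : comPzRingType)
    (charA : prime_char p A) (f : {rmorphism A -> B}) :
  local_ring A -> F_coherent charA -> weakly_etale f ->
  F_coherent (prime_char_rmorph f charA).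
Proof.
move=> _ cohA [flat_f flat_mult].
have f_Frobenius a :
    f (Frobenius charA a) = Frobenius (prime_char_rmorph f charA) (f a).
  exact: rmorphXn.
apply: fin_gen_relations_coherent.
apply: (@weakly_etale_fin_gen_relations _ _ (colim_map f_Frobenius)).
- exact/colim_map_equationally_flat/flat_module_equational.
- exact/colim_map_locally_separated/flat_mult_locally_separated.
- exact: coherent_fin_gen_relations.
Qed.
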